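(* Let $\pi$ be a probability measure on $\Phi_L$ and let $$\bar V_t^{(2)}:=\int_{\Phi_L}V_t^\varphi\,\pi(d\varphi)=\beta\int_{\Phi_L}\int_{(-\infty,t]}e^{-(X_t^\varphi-X_s^\varphi)}\,ds\,\pi(d\varphi),\quad t\in\mathbb R,$$ be the supCOGARCH 2 process. Assume that $\int_{\Phi_L}V_0^\varphi\,\pi(d\varphi)<\infty$ a.s. Then $(\bar V_t^{(2)})_{t\in\mathbb R}$ is strictly stationary.
   Context: Constants $\beta>0$, $\eta>0$ are fixed. $L=(L_t)_{t\in\mathbb R}$ is a two-sided real-valued Lévy process with Lévy measure $\nu_L$, and $S=(S_t)_{t\in\mathbb R}$ is the two-sided driftless subordinator $S_t=\sum_{0<s\le t}(\Delta L_s)^2$ for $t\ge0$, $S_t=-\sum_{t<s\le0}(\Delta L_s)^2$ for $t\le0$, with Lévy measure $\nu_S$ (image of $\nu_L$ under $y\mapsto y^2$). For $\varphi\ge0$, $$X_t^\varphi=\eta t-\sum_{0<s\le t}\log(1+\varphi\Delta S_s)\ (t\ge0),\qquad X_t^\varphi=\eta t+\sum_{t<s\le0}\log(1+\varphi\Delta S_s)\ (t<0).$$ $\Phi_L:=\{\varphi\ge0:\int_{(0,\infty)}\log(1+\varphi y)\,\nu_S(dy)<\eta\}$. For $\varphi\in\Phi_L$ the two-sided (stationary) COGARCH process is $V_t^\varphi=\beta\int_{(-\infty,t]}e^{-(X_t^\varphi-X_s^\varphi)}\,ds$, $t\in\mathbb R$. All $V^\varphi$ are driven by the same $S$. *)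

(* Defs.v *)
From HB Require Import structures.
From mathcomp Require Import all_boot all_order all_algebra.
From mathcomp Require Import all_classical all_reals all_analysis.
From mathcomp Require Import measurable_realfun.

Set Implicit Arguments.
Unset Strict Implicit.
Unset Printing Implicit Defensive.

Import Order.TTheory GRing.Theory Num.Theory.
Import numFieldNormedType.Exports.

Local Open Scope classical_set_scope.
Local Open Scope ring_scope.

Definition cadlag (R : realType) (f : R -> R) : Prop :=
  forall t, f x @[x --> t^'+] --> f t /\ cvg (f x @[x --> t^'-]).

Definition jump (R : realType) (f : R -> R) (s : R) : R :=
  f s - lim (f x @[x --> s^'-]).

(* A two-sided Levy process: the usual axioms, with the whole line as time
   set. Splitting at 0, this is the usual gluing of two independent
   copies (L_t)_{t >= 0} and (- L_{(-t)-})_{t >= 0}. *)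
Record two_sided_levy (R : realType) (d : measure_display)
    (T : measurableType d) (P : probability T R) (L : R -> T -> R) :
    Prop := TwoSidedLevy {
  levy_measurable : forall t, measurable_fun setT (L t) ;
  levy_start : {ae P, forall w, L 0 w = 0} ;
  levy_independent : forall (n : nat) (t : nat -> R) (B : nat -> set R),
    (forall i, (i < n)%N -> t i < t i.+1) ->
    (forall i, measurable (B i)) ->
    P (\big[setI/setT]_(i < n) [set w | B i (L (t i.+1) w - L (t i) w)]) =
    (\prod_(i < n) P [set w | B i (L (t i.+1) w - L (t i) w)%R])%E ;
  levy_stationary : forall (s t h : R) (B : set R), measurable B ->
    P [set w | B (L (t + h) w - L (s + h) w)] = P [set w | B (L t w - L s w)] ;
  levy_stochastically_continuous : forall (t e : R), 0 < e ->
    P [set w | e < `|L s w - L t w|] @[s --> t] --> 0%E ;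
  levy_cadlag : {ae P, forall w, cadlag (L ^~ w)}
}.

(* nu B is the expected number of nonzero jumps with size in B per unit of
   time. *)
Definition levy_measure (R : realType) (d : measure_display)
    (T : measurableType d) (P : probability T R) (L : R -> T -> R)
    (nu : {measure set R -> \bar R}) : Prop :=
  forall B : set R, measurable B ->
    nu B = (\int[P]_w counting
      [set s : R | [/\ (0 < s <= 1)%R, jump (L ^~ w) s <> 0%R
                     & B (jump (L ^~ w) s)]])%E.

(* The real-valued path s is the two-sided sum of the squared jumps of l. The
   equation in \bar R says in particular that these sums are finite. *)
Definition squared_jump_path (R : realType) (l s : R -> R) : Prop :=
  forall t : R,
    (0 <= t ->
       (s t)%:E = (\esum_(r in `]0%R, t]) ((jump l r) ^+ 2)%R%:E)%E) /\
    (t <= 0 ->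
       (s t)%:E = (- \esum_(r in `]t, 0%R]) ((jump l r) ^+ 2)%R%:E)%E).

Section cogarch.
Context (R : realType) (beta eta : R).

Definition Phi (nuL : {measure set R -> \bar R}) : set R :=
  [set phi | 0 <= phi /\
    (\int[pushforward nuL (fun y : R => (y ^+ 2)%R : R)]_(y in `]0%R, +oo[)
       (ln (1 + phi * y))%:E < eta%:E)%E].

(* X^phi and V^phi as functionals of a path s of S. If ln (1 + phi * .)
   sums over the jumps of s to a finite value, [fine] is the identity; this is
   always so for nondecreasing s and phi >= 0. *)
Definition cogarchX (s : R -> R) (phi t : R) : R :=
  if 0 <= t
  then eta * t -
    fine (\esum_(r in `]0%R, t]) (ln (1 + phi * jump s r))%:E)
  else eta * t +
    fine (\esum_(r in `]t, 0%R]) (ln (1 + phi * jump s r))%:E).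

Definition cogarchV (s : R -> R) (phi t : R) : \bar R :=
  (beta%:E * \int[lebesgue_measure]_(r in `]-oo, t])
     (expR (- (cogarchX s phi t - cogarchX s phi r)))%:E)%E.

Definition supcogarch2 (nuL : {measure set R -> \bar R})
    (pi : probability R R) (s : R -> R) (t : R) : \bar R :=
  (\int[pi]_(phi in Phi nuL) cogarchV s phi t)%E.

End cogarch.

(* Y is only required to be measurable for the completion of P, i.e., each Y t
   is a.s. equal to some measurable Z t; the finite-dimensional distributions
   of Y under the completion of P are those of Z under P. *)
Definition strictly_stationary (R : realType) (d : measure_display)
    (T : measurableType d) (P : probability T R) (Y : R -> T -> \bar R) :
    Prop :=
  exists Z : R -> T -> \bar R,
    [/\ forall t, measurable_fun setT (Z t),
        forall t, {ae P, forall w, Z t w = Y t w}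
      & forall (n : nat) (t : n.-tuple R) (h : R) (A : set (n.-tuple (\bar R))),
          measurable A ->
          P [set w | A [tuple Z (tnth t i + h) w | i < n]] =
          P [set w | A [tuple Z (tnth t i) w | i < n]]].

(* Main.v *)
(** The process [V^phi] is a functional of the path of [L]: since the jumps of
    [S] are the squared jumps of [L], [exp (- (X_t - X_r))] equals
    [exp (sum_(r < u <= t) ln (1 + phi (jump L u)^2) - eta (t - r))]. On a cadlag
    path this sum is a limit of sums over the increments of [L] along the meshes
    [t - i/(n+1)], provided that [y^2] is first replaced by
    [max (y^2 - 1/(k+1)) 0], so that only finitely many jumps count; then
    [k -> oo]. Hence [exp (- (X_t - X_r))] is an iterated limsup of measurable
    functions of countably many increments, defined on all paths and jointly
    measurable in the path, [phi] and [r], and Tonelli's theorem shows that the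
    superposition is a.s. a functional [F_t] of the path, measurable for the
    sigma-algebra generated by the increments. It is shift covariant,
    [F_(t+h) f = F_t (f (. + h))], because Lebesgue measure is translation
    invariant. Finally the law of [L (. + h)] on this sigma-algebra does not
    depend on [h], by uniqueness of measures on pi-systems applied twice: to the
    rectangles of successive increments, then to the sets depending on finitely
    many increments. *)

Require Import Defs.
From HB Require Import structures.
From mathcomp Require Import all_boot all_order all_algebra.
From mathcomp Require Import all_classical all_reals all_analysis.
From mathcomp Require Import measurable_realfun.
From mathcomp Require Import lra.

Set Implicit Arguments.
Unset Strict Implicit.
Unset Printing Implicit Defensive.

Import Order.TTheory GRing.Theory Num.Theory.
Import numFieldNormedType.Exports.

Local Open Scope classical_set_scope.
Local Open Scope ring_scope.

(** * Jumps of cadlag paths *)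

Section cadlag_paths.
Context {R : realType}.
Implicit Types (f g : R -> R) (J : seq R).

Lemma cadlag_right f (t e : R) : cadlag f -> 0 < e ->
  exists2 d, 0 < d & forall x, t <= x < t + d -> `|f x - f t| < e.
Proof.
move=> /(_ t)[/cvgrPdist_lt H _] e0; have [d /= d0 Hd] := H _ e0.
exists d => // x /andP[].
rewrite le_eqVlt => /predU1P[<- _|tx xd]; first by rewrite subrr normr0.
by rewrite distrC Hd//= ltr0_norm; lra.
Qed.

Lemma cadlag_left f (t e : R) : cadlag f -> 0 < e ->
  exists2 d, 0 < d & forall x, t - d < x < t ->
    `|f x - lim (f z @[z --> t^'-])| < e.
Proof.
move=> /(_ t)[_ /cvgrPdist_lt/(_ e)H] /H[d /= d0 Hd]; exists d => // x /andP[dx xt].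
by rewrite distrC Hd//= ger0_norm; lra.
Qed.

(* [J] collects the ends of intervals on which [f] oscillates less than [e];
   the largest [c] for which [a, c] is covered by finitely many of them is [b]
   by the one-sided limits at [c]. *)
Lemma cadlag_partition f (e a b : R) : cadlag f -> 0 < e -> a <= b ->
  exists J, forall x y, a <= x -> x < y -> y <= b ->
    (forall u, u \in J -> ~~ (x < u <= y)) -> `|f y - f x| < e.
Proof.
move=> cf e0 ab.
pose Q c := exists J, forall x y, a <= x -> x < y -> y <= c ->
    (forall u, u \in J -> ~~ (x < u <= y)) -> `|f y - f x| < e.
pose E := [set c | a <= c <= b /\ Q c].
have Ea : E a.
  by split; [lra|exists [::] => x y ax xy ya; lra].
have Eb : has_ubound E by exists b => c [/andP[]].
have supE : has_sup E by split => //; exists a.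
pose s := sup E.
have as_ : a <= s by exact: ub_le_sup.
have e20 : 0 < e / 2 by lra.
have [d1 d10 H1] := cadlag_right s cf e20.
have [d2 d20 H2] := cadlag_left s cf e20.
have [c [/andP[ac cb] [J HJ]] sc] := sup_adherent d20 supE.
have cs : c <= s by apply: ub_le_sup => //; split; [lra|exists J].
have Qs : Q (s + d1 / 2).
  (* With [c] and [s] added, [x] and [y] lie on the same side of each of them: below [c] the old [J]
     applies, from [c] up to [s] both values are within [e / 2] of the left limit at [s], and from
     [s] on within [e / 2] of [f s]. *)
  exists (c :: s :: J) => x y ax xy ys HJ'.
  have [xc|cx] := ltP x c.
    have := HJ' c (mem_head _ _); rewrite xc/= -ltNge => yc.
    apply: HJ => //; first exact: ltW.
    by move=> u uJ; apply: HJ'; rewrite !inE uJ !orbT.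
  have [xs|sx] := ltP x s.
    have := HJ' s; rewrite !inE eqxx orbT xs/= -ltNge => /(_ isT) ys'.
    have := H2 x; have := H2 y; rewrite -/s in sc *.
    have -> : s - d2 < x < s by lra.
    have -> : s - d2 < y < s by lra.
    move=> /(_ isT) + /(_ isT).
    by rewrite !ltr_norml => /andP[? ?] /andP[? ?]; lra.
  have := H1 x; have := H1 y.
  have -> : s <= x < s + d1 by lra.
  have -> : s <= y < s + d1 by lra.
  move=> /(_ isT) + /(_ isT).
  by rewrite !ltr_norml => /andP[? ?] /andP[? ?]; lra.
have [bs|sb] := leP b (s + d1 / 2).
  by case: Qs => J' HJ'; exists J' => x y ax xy yb; apply: HJ' => //; lra.
suff : s + d1 / 2 <= s by lra.
by apply: ub_le_sup => //; split => //; lra.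
Qed.

Lemma jump_le f (a u e : R) : cadlag f -> a < u ->
  (forall x, a <= x -> x < u -> `|f u - f x| < e) -> `|jump f u| <= e.
Proof.
move=> cf au H; apply/ler_addgt0Pr => d d0.
have [d2 d20 H2] := cadlag_left u cf d0.
pose x := Num.max a (u - d2 / 2).
have xu : x < u by rewrite gt_max au; lra.
have ax : a <= x by rewrite le_max lexx.
have ux : u - d2 < x by rewrite lt_max; apply/orP; right; lra.
have := H x ax xu; have := H2 x; rewrite ux xu => /(_ isT).
rewrite /jump; set l := lim _.
rewrite !ltr_norml ler_norml => /andP[? ?] /andP[? ?]; lra.
Qed.

(** The maximum of [c] and the entries of [J] below [u] serves as [a]. It isolates [u] on the left
    from finitely many exceptional points. *)
Lemma seq_separate_left J (c u : R) : c < u ->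
  exists a, [/\ c <= a, a < u & forall v, v \in J -> v < u -> v <= a].
Proof.
move=> cu; exists (foldr Num.max c [seq v <- J | v < u]).
split; elim: J => [|w s IH] //=.
- by case: ifP => //= _; rewrite le_max IH orbT.
- by case: ifP => //= wu; rewrite gt_max wu.
- move=> v; rewrite inE => /predU1P[->|vs] vu; first by rewrite vu /= le_max lexx.
  by case: ifP => _ /=; rewrite ?le_max IH ?orbT.
Qed.

Lemma near_all_seq {T : choiceType} {U : Type} (F : set_system U) {FF : Filter F}
    (s : seq T) (P : T -> U -> Prop) :
  (forall x, x \in s -> \forall n \near F, P x n) ->
  \forall n \near F, forall x, x \in s -> P x n.
Proof.
elim: s => [|y s IH] H; first exact: nearW.
have Hy := H y (mem_head _ _).
have Hs := IH (fun x xs => H x (mem_behead (s := y :: s) xs)).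
by apply: filterS2 Hy Hs => n Py Ps x; rewrite inE => /predU1P[->|/Ps].
Qed.

Lemma cvg_sum_seq {T : choiceType} {U : Type} (F : set_system U) {FF : Filter F}
    (s : seq T) (h : U -> T -> R) (l : T -> R) :
  (forall x, x \in s -> h n x @[n --> F] --> l x) ->
  \sum_(x <- s) h n x @[n --> F] --> \sum_(x <- s) l x.
Proof.
elim: s => [|y s IH] H.
  by under eq_fun do rewrite big_nil; rewrite big_nil; exact: cvg_cst.
under eq_fun do rewrite big_cons; rewrite big_cons; apply: cvgD.
  exact: H (mem_head _ _).
by apply: IH => x xs; apply: H; rewrite inE xs orbT.
Qed.

(** The mesh is anchored at [t], so that it moves with [t] under time shifts. The range of [i] does
    not depend on [r], which enters only through a measurable test; the test keeps the mesh
    intervals inside [[r, t]], and the range contains all of these once [n.+1 >= t - r]. *)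
Definition mesh_sum g f (r t : R) (n : nat) : R :=
  \sum_(0 <= i < n.+1 ^ 2)
    if i.+1%:R <= (t - r) * n.+1%:R
    then g (f (t - i%:R / n.+1%:R) - f (t - i.+1%:R / n.+1%:R)) else 0.

Lemma near_mesh (d : R) : 0 < d -> \forall n \near \oo, 1 <= d * n.+1%:R.
Proof.
move=> d0; near=> n.
have : d^-1 < n%:R by near: n; exact: nbhs_infty_gtr.
by move=> /ltW h; rewrite mulrC -ler_pdivrMr// div1r (le_trans h)// ler_nat.
Unshelve. all: by end_near. Qed.

Definition mesh_index (t u : R) (n : nat) : nat :=
  Num.truncn ((t - u) * n.+1%:R).

Lemma mesh_indexP (t u : R) n i : u <= t ->
  (mesh_index t u n == i) =
  (t - i.+1%:R / n.+1%:R < u <= t - i%:R / n.+1%:R).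
Proof.
move=> ut; have n0 : 0 < n.+1%:R :> R by [].
rewrite /mesh_index truncn_eq ?mulr_ge0 ?subr_ge0// andbC; congr (_ && _).
  by rewrite ltrBlDl -ltrBlDr ltr_pdivlMr.
by rewrite lerBrDr -lerBrDl ler_pdivrMr.
Qed.

Lemma sum_support_seq (V : nmodType) (F : nat -> V) (M : seq nat) (N : nat) :
  uniq M -> (forall i, i \in M -> (i < N)%N) ->
  (forall i, i \notin M -> F i = 0) ->
  \sum_(0 <= i < N) F i = \sum_(i <- M) F i.
Proof.
move=> uM MN F0; rewrite (bigID (mem M))/= [X in _ + X]big1 ?addr0//.
rewrite -big_filter; apply: perm_big; apply: uniq_perm => //.
  by rewrite filter_uniq// iota_uniq.
move=> i; rewrite mem_filter mem_index_iota /=.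
by case: (boolP (i \in M)) => // /MN ->.
Qed.

(** The mesh interval around [u] is open on the left and closed on the right: its right end is at
    least [u], where right continuity applies, and its left end is strictly below [u], which yields
    the left limit. *)
Lemma cvg_mesh_increment f (t u : R) : cadlag f -> u <= t ->
  f (t - (mesh_index t u n)%:R / n.+1%:R)
  - f (t - (mesh_index t u n).+1%:R / n.+1%:R) @[n --> \oo] --> jump f u.
Proof.
move=> cf ut; apply/cvgrPdist_lt => e e0.
have e20 : 0 < e / 2 by lra.
have [d1 d10 H1] := cadlag_right u cf e20.
have [d2 d20 H2] := cadlag_left u cf e20.
near=> n; set i := mesh_index t u n.
have := mesh_indexP n i ut; rewrite eqxx => /esym/andP[iu ui].
have n0 : 0 < n.+1%:R :> R by [].
have step : t - i%:R / n.+1%:R = t - i.+1%:R / n.+1%:R + n.+1%:R^-1.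
  by rewrite -[i.+1%:R]natr1 mulrDl mul1r opprD addrA subrK.
have nd1 : n.+1%:R^-1 <= d1 :> R.
  by rewrite -div1r ler_pdivrMr//; near: n; exact: near_mesh.
have nd2 : n.+1%:R^-1 <= d2 / 2 :> R.
  by rewrite -div1r ler_pdivrMr//; near: n; apply: near_mesh; lra.
have := H1 (t - i%:R / n.+1%:R); have := H2 (t - i.+1%:R / n.+1%:R).
rewrite step in ui *.
set x := t - _ / _ in iu ui *; set z := _^-1 in iu ui nd1 nd2 *.
clearbody x z.
have -> : u - d2 < x < u by lra.
have -> : u <= x + z < u + d1 by lra.
move=> /(_ isT) + /(_ isT); rewrite /jump; set l := lim _.
by rewrite !ltr_norml => /andP[? ?] /andP[? ?]; lra.
Unshelve. all: by end_near. Qed.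

(* By [cadlag_partition], an increment larger than [e] lies over a mesh interval
   that meets a fixed finite set [J], and for a fine mesh each point of [J] has
   a mesh interval of its own. *)
Lemma cvg_mesh_sum g f (r t e : R) : cadlag f -> r <= t -> 0 < e ->
  continuous g -> (forall y, `|y| <= e -> g y = 0) ->
  exists J, [/\ uniq J, forall u, u \in J -> r < u <= t,
    forall u, r < u <= t -> u \notin J -> g (jump f u) = 0 &
    mesh_sum g f r t n @[n --> \oo] --> \sum_(u <- J) g (jump f u)].
Proof.
move=> cf rt e0 cg g0.
have [J0 HJ0] := cadlag_partition cf e0 rt.
pose J := [seq u <- undup J0 | r < u <= t].
have JP u : u \in J = (r < u <= t) && (u \in J0).
  by rewrite mem_filter mem_undup.
have HJ x y : r <= x -> x < y -> y <= t ->
    (forall u, u \in J -> ~~ (x < u <= y)) -> `|f y - f x| < e.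
  move=> rx xy yt H; apply: HJ0 => // u uJ0.
  have [utr|] := boolP (r < u <= t); first by apply: H; rewrite JP utr.
  by apply: contra => ?; lra.
have uJ : uniq J by rewrite filter_uniq// undup_uniq.
exists J; split => //.
- by move=> u; rewrite JP => /andP[].
- move=> u ru uJn; apply: g0.
  (* No point of [J] lies in []a, u]], so [f u] differs by less than [e] from the values on [[a,
     u[], and the jump at [u] is at most [e]. *)
  have [a [ra au aJ]] := seq_separate_left J (proj1 (andP ru)).
  apply: (@jump_le f a) => // x ax xu; apply: HJ => //; [lra|lra|].
  move=> v vJ; apply/negP => /andP[xv]; rewrite le_eqVlt => /predU1P[vu|vu].
    by rewrite -vu vJ in uJn.
  by have := aJ v vJ vu; lra.
suff : \forall n \near \oo, \sum_(u <- J)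
    g (f (t - (mesh_index t u n)%:R / n.+1%:R)
       - f (t - (mesh_index t u n).+1%:R / n.+1%:R)) = mesh_sum g f r t n.
  move=> H; apply: (cvg_trans (near_eq_cvg H)).
  apply: cvg_sum_seq => u; rewrite JP => /andP[/andP[_ ut] _].
  by apply: continuous_cvg; [exact: cg|exact: cvg_mesh_increment].
(* [Hr] makes the mesh interval of each point of [J] pass the test in [mesh_sum]; [Hd] gives
   distinct points of [J] distinct mesh indices. *)
have Hr : \forall n \near \oo, forall u, u \in J -> 1 <= (u - r) * n.+1%:R.
  apply: near_all_seq => u; rewrite JP => /andP[/andP[ru _] _].
  by apply: near_mesh; lra.
have Hd : \forall n \near \oo, forall u, u \in J ->
    forall v, v \in J -> u < v -> 1 <= (v - u) * n.+1%:R.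
  apply: near_all_seq => u _; apply: near_all_seq => v _.
  have [uv|vu] := ltP u v; last by apply: nearW.
  have /near_mesh : 0 < v - u by lra.
  by apply: filterS => n.
near=> n.
have n0 : 0 < n.+1%:R :> R by [].
rewrite /mesh_sum (@sum_support_seq _ _ [seq mesh_index t u n | u <- J]).
- rewrite big_map big_seq [RHS]big_seq; apply: eq_bigr => u uJ'.
  move: (uJ'); rewrite JP => /andP[/andP[ru ut] _].
  have := mesh_indexP n (mesh_index t u n) ut; rewrite eqxx => /esym/andP[h1 h2].
  rewrite ifT// -natr1.
  have : 1 <= (u - r) * n.+1%:R by move: u uJ' {ru ut h1 h2}; near: n.
  move: h2; rewrite lerBrDr -lerBrDl ler_pdivrMr//; nra.
- rewrite map_inj_in_uniq// => u v uJ' vJ'.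
  wlog : u v uJ' vJ' / u < v.
    move=> H uv; have [/H|/H|//] := ltgtP u v; first exact.
    by move=> /(_ vJ' uJ' (esym uv)).
  move=> uv huv.
  have : 1 <= (v - u) * n.+1%:R by move: u uJ' v vJ' uv {huv}; near: n.
  move: (uJ') (vJ'); rewrite !JP => /andP[/andP[ru ut] _] /andP[/andP[rv vt] _].
  have := mesh_indexP n (mesh_index t u n) ut; rewrite eqxx => /esym/andP[h1 h2].
  have := mesh_indexP n (mesh_index t v n) vt; rewrite eqxx => /esym/andP[h3 h4].
  rewrite -huv -natr1 mulrDl in h1 h3 h4 h2.
  rewrite -ler_pdivrMr//; move: h1 h2 h3 h4.
  by move: (_ / _) (1 / _) => x y; lra.
- move=> i /mapP[u + ->]; rewrite JP => /andP[/andP[ru ut] _].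
  have : 0 <= (t - u) * n.+1%:R by rewrite mulr_ge0//; lra.
  move=> /truncn_lt_nat ->; rewrite natrX expr2 ltr_pM2r//.
  have : t - r < n%:R by near: n; exact: nbhs_infty_gtr.
  by rewrite -natr1; lra.
- move=> i iJ; case: ifPn => // it; apply/g0/ltW/HJ.
  + by rewrite lerBrDr -lerBrDl ler_pdivrMr.
  + by rewrite ltrD2l ltrN2 ltr_pM2r ?invr_gt0// ltr_nat.
  + by rewrite lerBlDl lerDr divr_ge0.
  + move=> u uJ'; apply: contra iJ => H.
    move: (uJ'); rewrite JP => /andP[/andP[ru ut] _].
    by apply/mapP; exists u => //; apply/esym/eqP; rewrite mesh_indexP.
Unshelve. all: by end_near. Qed.

End cadlag_paths.

(** * Sums over the jumps *)

Section esum_real.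
Context {R : realType}.
Local Open Scope ereal_scope.

Lemma esum_fin_approx {T : choiceType} (D : set T) (a : T -> R) (v e : R) :
  \esum_(u in D) (a u)%:E = v%:E -> (0 < e)%R ->
  exists J : seq T, [/\ uniq J, forall u, u \in J -> D u &
    (v - e < \sum_(u <- J) a u)%R].
Proof.
move=> H e0.
have : (v - e)%:E < \esum_(u in D) (a u)%:E by rewrite H lte_fin; lra.
move=> /ereal_sup_gt[_ [X [finX XD] <-]].
rewrite fsbig_finite//= sumEFin lte_fin => Xv.
exists (finmap.enum_fset (fset_set X)); split => //.
by move=> u; rewrite in_fset_set// inE => /XD.
Qed.

Lemma esum_ge_seq {T : choiceType} (D : set T) (a : T -> R) (J : seq T) :
  uniq J -> (forall u, u \in J -> D u) ->
  (\sum_(u <- J) a u)%:E <= \esum_(u in D) (a u)%:E.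
Proof.
move=> uJ JD; apply: esum_ge; exists [set` J].
  by split => //=; exact: finite_seq.
by rewrite -fsbig_seq//= sumEFin.
Qed.

Lemma esum_seq {T : choiceType} (D : set T) (a : T -> R) (J : seq T) :
  (forall u, D u -> (0 <= a u)%R) ->
  uniq J -> (forall u, u \in J -> D u) ->
  (forall u, D u -> u \notin J -> a u = 0%R) ->
  \esum_(u in D) (a u)%:E = (\sum_(u <- J) a u)%:E.
Proof.
move=> a0 uJ JD aJ.
rewrite (esumID [set` J]); last by move=> u /a0; rewrite lee_fin.
rewrite [X in _ + X]esum1 ?adde0; last first.
  by move=> u [Du /= /negP uJ']; rewrite aJ.
rewrite (_ : D `&` _ = [set` J]); last first.
  by apply/seteqP; split => [u []//|u /= uJ']; split => //; exact: JD.
rewrite esum_fset//; first by rewrite -fsbig_seq//= sumEFin.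
by move=> u; rewrite inE /= => /JD/a0; rewrite lee_fin.
Qed.

(** A sandwich: a finite [J] carries the sum of [a] up to [e / 2], and [vk k] lies between the sum
    of [ak k] over [J], which converges to that of [a], and [v]. *)
Lemma cvg_esum {T : choiceType} (D : set T) (a : T -> R)
    (ak : nat -> T -> R) (v : R) (vk : nat -> R) :
  (forall k u, D u -> (ak k u <= a u)%R) ->
  (forall u, D u -> ak k u @[k --> \oo] --> a u) ->
  \esum_(u in D) (a u)%:E = v%:E ->
  (forall k, \esum_(u in D) (ak k u)%:E = (vk k)%:E) ->
  vk k @[k --> \oo] --> v.
Proof.
move=> aka cak av akv; apply/cvgrPdist_lt => e e0.
have e20 : (0 < e / 2)%R by lra.
have [J [uJ JD Jv]] := esum_fin_approx av e20.
have : (\sum_(u <- J) ak k u)%R @[k --> \oo] --> (\sum_(u <- J) a u)%R.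
  by apply: cvg_sum_seq => u /JD; exact: cak.
move=> /cvgrPdist_lt/(_ _ e20); apply: filterS => k.
have : (\sum_(u <- J) ak k u <= vk k)%R.
  by rewrite -lee_fin -akv; exact: esum_ge_seq.
have : (vk k <= v)%R.
  by rewrite -lee_fin -akv -av; apply: le_esum => u Du; rewrite lee_fin aka.
rewrite !ltr_norml => ? ? /andP[? ?]; lra.
Qed.

Lemma esum_itv_split (a b c : R) (F : R -> \bar R) : (a <= b)%R -> (b <= c)%R ->
  (forall u, 0 <= F u) ->
  \esum_(u in `]a, c]) F u = \esum_(u in `]a, b]) F u + \esum_(u in `]b, c]) F u.
Proof.
move=> ab bc F0; rewrite (esumID `]a, b]%classic)//.
have -> : `]a, c]%classic `&` `]a, b]%classic = `]a, b]%classic.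
  by apply/seteqP; split => u /=; rewrite !in_itv/=; [case|move=> ?; split; lra].
have -> : `]a, c]%classic `&` ~` `]a, b]%classic = `]b, c]%classic.
  apply/seteqP; split => u /=; rewrite !in_itv/=.
    by move=> [/andP[au uc]] /negP; rewrite au/= -ltNge uc => ->.
  by move=> /andP[bu uc]; split; [lra|apply/negP; lra].
by [].
Qed.

End esum_real.

(** * The squared-jump path and the increments of [X^phi] *)

Section squared_jumps.
Context {R : realType} (l s : R -> R) (sq : squared_jump_path l s).

Let q u := jump l u ^+ 2.

(** The formulas on the two half-lines are glued at 0. Being equations between a real number and a
    sum in [\bar R], they exclude infinite sums, so that differences can be taken. *)
Lemma squared_jump_pathB (a b : R) : a <= b ->
  (\esum_(u in `]a, b]) (q u)%:E = (s b - s a)%:E)%E.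
Proof.
move=> ab.
have q0 u : (0 <= (q u)%:E)%E by rewrite lee_fin sqr_ge0.
have [sa0 sa1] := sq a; have [sb0 sb1] := sq b.
rewrite -/q in sa0 sa1 sb0 sb1.
have [a0|a0] := leP 0 a.
  have := sb0 (le_trans a0 ab); rewrite (esum_itv_split a0 ab)// -(sa0 a0).
  by case: esum => //= x [->]; congr _%:E; lra.
have [b0|b0] := leP b 0.
  have := sa1 (ltW a0); rewrite (esum_itv_split ab b0)//.
  have := sb1 b0.
  case: esum => [x||]; case: esum => [y||] //= [->] [->].
  by congr _%:E; lra.
rewrite (esum_itv_split (ltW a0) (ltW b0))// -sb0 ?ltW//.
have := sa1 (ltW a0).
by case: esum => //= x [->]; congr _%:E; lra.
Qed.

(** A finite [J] carries the squared jumps on []u - 1, u]] up to [e]. If [a < u] lies above the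
    points of [J] below [u], then for [x] in []a, u[] the increment [s u - s x] is at least [q u]
    and less than [q u + e]. *)
Lemma jump_squared (u : R) : jump s u = q u.
Proof.
rewrite /jump (_ : lim _ = s u - q u); first by rewrite opprB addrC subrK.
apply/cvg_lim => //; apply/cvgrPdist_lt => e e0.
have u1 : u - 1 <= u by lra.
have [J [uJ Jin Jv]] := esum_fin_approx (squared_jump_pathB u1) e0.
have u1' : u - 1 < u by lra.
have [a [ra au aJ]] := seq_separate_left J u1'.
near=> x.
have xu : x < u by near: x; exact: nbhs_left_lt.
have ax : a < x by near: x; exact: nbhs_left_gt.
have q1 : q u <= s u - s x.
  rewrite -lee_fin -squared_jump_pathB; last exact: ltW.
  have := @esum_ge_seq R _ `]x, u]%classic q [:: u] isT.
  rewrite big_seq1; apply => v; rewrite inE => /eqP ->.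
  by rewrite /= in_itv/= xu lexx.
have q2 : \sum_(v <- J) q v <= (s a - s (u - 1)) + q u.
  rewrite -lee_fin EFinD -squared_jump_pathB//.
  have {1}-> : \sum_(v <- J) q v =
      \sum_(v <- J | v != u) q v + \sum_(v <- J | v == u) q v.
    by rewrite addrC [LHS](bigID (pred1 u)).
  rewrite EFinD leeD//; last first.
    have [uin|unin] := boolP (u \in J).
      by rewrite lee_fin -big_filter filter_pred1_uniq// big_seq1.
    rewrite lee_fin big_hasC ?sqr_ge0//; apply/hasPn => v vJ /=.
    by apply: contra unin => /eqP <-.
  rewrite -big_filter; apply: esum_ge_seq; first exact: filter_uniq.
  move=> v; rewrite mem_filter => /andP[vu vJ].
  have := Jin v vJ; rewrite /= !in_itv/= => /andP[-> vu'].
  by apply: aJ => //; rewrite lt_neqAle vu.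
have q3 : s a <= s x.
  rewrite -subr_ge0 -lee_fin -squared_jump_pathB; last exact: ltW.
  by apply: esum_ge0 => v _; rewrite lee_fin sqr_ge0.
by rewrite ltr_norml; lra.
Unshelve. all: by end_near. Qed.

(** By [ln (1 + x) <= x], each finite partial sum is at most [phi] times the increment of [s]. *)
Lemma log_sum_fin (phi a b : R) : 0 <= phi -> a <= b ->
  (\esum_(u in `]a, b]) (ln (1 + phi * q u))%:E \is a fin_num)%E.
Proof.
move=> phi0 ab.
have ln0 u : 0 <= ln (1 + phi * q u).
  by rewrite ln_ge0// lerDl mulr_ge0// sqr_ge0.
have pq0 u : 0 <= phi * q u by rewrite mulr_ge0// sqr_ge0.
apply/fin_numPlt/andP; split.
  by rewrite (@lt_le_trans _ _ 0%E)// esum_ge0// => u _; rewrite lee_fin.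
apply: (@le_lt_trans _ _ (phi * (s b - s a))%:E); last exact: ltry.
apply: ge_ereal_sup => _ [X [finX XD] <-].
rewrite fsbig_finite//= sumEFin lee_fin.
apply: (@le_trans _ _ (phi * \sum_(u <- finmap.enum_fset (fset_set X)) q u)).
  rewrite mulr_sumr; apply: ler_sum => u _.
  by apply: le_ln1Dx; have := pq0 u; lra.
rewrite ler_wpM2l// -lee_fin -squared_jump_pathB//; apply: esum_ge_seq => //.
by move=> u; rewrite in_fset_set// inE => /XD.
Qed.

(** The log sums are finite, so [fine] is additive over adjacent intervals and the case distinction
    at time 0 disappears. *)
Lemma cogarchX_increment (eta phi r t : R) : 0 <= phi -> r <= t ->
  cogarchX eta s phi t - cogarchX eta s phi r =
  eta * (t - r) - fine (\esum_(u in `]r, t]) (ln (1 + phi * q u))%:E).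
Proof.
move=> phi0 rt; rewrite /cogarchX.
have E a b : (\esum_(u in `]a, b]) (ln (1 + phi * jump s u))%:E =
    \esum_(u in `]a, b]) (ln (1 + phi * q u))%:E)%E.
  by apply: eq_esum => u _; rewrite jump_squared.
have F0 u : (0 <= (ln (1 + phi * q u))%:E)%E.
  by rewrite lee_fin ln_ge0// lerDl mulr_ge0// sqr_ge0.
have split a b c : a <= b -> b <= c ->
  fine (\esum_(u in `]a, c]) (ln (1 + phi * q u))%:E) =
  fine (\esum_(u in `]a, b]) (ln (1 + phi * q u))%:E) +
  fine (\esum_(u in `]b, c]) (ln (1 + phi * q u))%:E).
  by move=> ab bc; rewrite (esum_itv_split ab bc)// fineD// log_sum_fin.
rewrite !E; have [r0|r0] := leP 0 r.
  by rewrite (le_trans r0 rt) (split 0 r t)//; lra.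
have [t0|t0] := leP 0 t.
  by rewrite (split r 0 t)// 1?ltW//; lra.
by rewrite (split r t 0)// 1?ltW//; lra.
Qed.

End squared_jumps.

(** * The discount factor as an iterated limsup over meshes *)

Section discount.
Context {R : realType}.
Implicit Types (f l s : R -> R) (eta phi r t : R).

(* The truncation of [y ^+ 2] makes this vanish near 0, which kills the
   contribution of the continuous part of the path to the mesh sums. *)
Definition cut_log phi (k : nat) (y : R) : R :=
  ln (1 + phi * Num.max (y ^+ 2 - k.+1%:R^-1) 0).

Definition discount_approx eta f t phi r (k n : nat) : \bar R :=
  (expR (mesh_sum (cut_log phi k) f r t n - eta * (t - r)))%:E.

Definition discount eta f t phi r : \bar R :=
  limn_esup (fun k => limn_esup (discount_approx eta f t phi r k)).

Lemma cut_log_ge0 phi k y : 0 <= phi -> 0 <= cut_log phi k y.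
Proof. by move=> p0; rewrite ln_ge0// lerDl mulr_ge0// le_max lexx orbT. Qed.

Lemma cut_log_le phi k y : 0 <= phi -> cut_log phi k y <= ln (1 + phi * y ^+ 2).
Proof.
move=> p0; have y2 : 0 <= y ^+ 2 by exact: sqr_ge0.
have k0 : 0 < k.+1%:R^-1 :> R by rewrite invr_gt0.
have m0 : 0 <= Num.max (y ^+ 2 - k.+1%:R^-1) 0 by rewrite le_max lexx orbT.
rewrite ler_ln ?posrE.
- by rewrite lerD2l ler_wpM2l// ge_max y2 andbT gerBl ltW.
- by rewrite ltr_wpDr ?mulr_ge0.
- by rewrite ltr_wpDr// mulr_ge0.
Qed.

Lemma cut_log0 phi k y : `|y| <= k.+1%:R^-1 -> cut_log phi k y = 0.
Proof.
move=> yk; rewrite /cut_log (_ : Num.max _ _ = 0) ?mulr0 ?addr0 ?ln1//.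
apply/max_idPr; rewrite subr_le0 -real_normK ?num_real//.
(* Since the threshold is at most 1, its square does not exceed it; the same threshold thus serves
   for [y] and for [y ^+ 2]. *)
have k1 : k.+1%:R^-1 <= 1 :> R by rewrite invf_le1// ler1n.
rewrite expr2 (le_trans (ler_pM _ _ yk yk))//.
by rewrite ger_pMr ?invr_gt0.
Qed.

Lemma cvg_max0 {U : Type} (F : set_system U) {FF : Filter F} (h : U -> R) (a : R) :
  h z @[z --> F] --> a -> Num.max (h z) 0 @[z --> F] --> Num.max a 0.
Proof.
move=> ha; apply: (@continuous_cvg _ _ _ _ _ h (fun z => Num.max z 0)) => //.
apply: (@continuous_max R R idfun (cst 0)); first exact: cvg_id.
exact: cvg_cst.
Qed.

Lemma continuous_cut_log phi k : 0 <= phi -> continuous (cut_log phi k).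
Proof.
move=> p0 y; pose inner z := 1 + phi * Num.max (z ^+ 2 - k.+1%:R^-1) 0.
apply: (@continuous_cvg _ _ _ _ _ inner (@ln R)).
  by apply: continuous_ln; rewrite ltr_wpDr// mulr_ge0// le_max lexx orbT.
apply: cvgD; first exact: cvg_cst.
apply: cvgM; first exact: cvg_cst.
apply: cvg_max0; apply: cvgB; [exact: exprn_continuous|exact: cvg_cst].
Qed.

Lemma cvg_cut_log phi y : 0 <= phi ->
  cut_log phi k y @[k --> \oo] --> ln (1 + phi * y ^+ 2).
Proof.
move=> p0; have y2 : 0 <= y ^+ 2 by exact: sqr_ge0.
apply: (@continuous_cvg _ _ _ _ _
  (fun k => 1 + phi * Num.max (y ^+ 2 - k.+1%:R^-1) 0) (@ln R)).
  by apply: continuous_ln; rewrite ltr_wpDr// mulr_ge0.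
apply: cvgD; first exact: cvg_cst.
apply: cvgM; first exact: cvg_cst.
have {2}-> : y ^+ 2 = Num.max (y ^+ 2 - 0) 0 by rewrite subr0; apply/esym/max_idPl.
apply: cvg_max0.
by apply: cvgB; [exact: cvg_cst|exact: cvg_harmonic].
Qed.

(** For fixed [k], [cvg_mesh_sum] with threshold [k.+1%:R^-1] gives the inner limit, a sum [w k] of
    truncated logarithms; [cvg_esum] then gives the limit of [w]. Both limsups are therefore limits,
    and [expR] is continuous. *)
Lemma discountE eta l s phi r t : cadlag l -> squared_jump_path l s ->
  0 <= phi -> r <= t ->
  discount eta l t phi r =
  (expR (- (cogarchX eta s phi t - cogarchX eta s phi r)))%:E.
Proof.
move=> cl sq p0 rt; rewrite (cogarchX_increment sq)//.
have := log_sum_fin sq p0 rt; move/fineK; set v := fine _ => /esym Ev.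
have Hk k : exists2 w, (\esum_(u in `]r, t]) (cut_log phi k (jump l u))%:E = w%:E)%E
    & mesh_sum (cut_log phi k) l r t n @[n --> \oo] --> w.
  have k0 : 0 < k.+1%:R^-1 :> R by rewrite invr_gt0.
  have [J [uJ J1 J2 J3]] := cvg_mesh_sum cl rt k0
    (continuous_cut_log (k := k) p0) (@cut_log0 phi k).
  exists (\sum_(u <- J) cut_log phi k (jump l u)) => //.
  by rewrite (esum_seq (J := J))// => u _; exact: cut_log_ge0.
have {Hk} [w Hw] := choice (fun k => let: ex_intro2 w a b := Hk k in
  ex_intro (fun w => _ /\ _) w (conj a b)).
have cw : w k @[k --> \oo] --> v.
  apply: (cvg_esum (a := fun u => ln (1 + phi * jump l u ^+ 2))) Ev _ => //.
  - by move=> k u _; exact: cut_log_le.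
  - by move=> u _; exact: cvg_cut_log.
  - by move=> k; have [] := Hw k.
have inner k : limn_esup (discount_approx eta l t phi r k) =
    (expR (w k - eta * (t - r)))%:E.
  apply: (cvg_limn_einf_sup _).2; apply: cvg_EFin; first exact: nearW.
  apply: (@continuous_cvg _ _ _ _ _ _ (@expR R)); first exact: continuous_expR.
  by apply: cvgB; [have [] := Hw k|exact: cvg_cst].
rewrite /discount; under eq_fun do rewrite inner.
rewrite opprB; apply: (cvg_limn_einf_sup _).2.
apply: cvg_EFin; first exact: nearW.
apply: (@continuous_cvg _ _ _ _ _ _ (@expR R)); first exact: continuous_expR.
by apply: cvgB => //; exact: cvg_cst.
Qed.

Lemma discount_ge0 eta f t phi r : (0 <= discount eta f t phi r)%E.
Proof.
have le_esup (u : (\bar R)^nat) : (forall n, 0 <= u n)%E -> (0 <= limn_esup u)%E.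
  move=> u0; rewrite limn_esup_lim; apply: lime_ge; first exact: is_cvg_esups.
  apply: nearW => n; apply: (le_trans (u0 n)); apply: ereal_sup_ubound.
  by exists n => /=.
by apply: (le_esup) => k; apply: (le_esup) => n; rewrite lee_fin expR_ge0.
Qed.

Lemma discount_shift eta f t phi r h :
  discount eta f (t + h) phi (r + h) = discount eta (fun u => f (u + h)) t phi r.
Proof.
have E a : t + h - a = t - a + h by lra.
congr limn_esup; apply/funext => k; congr limn_esup; apply/funext => n.
rewrite /discount_approx /mesh_sum (_ : t + h - (r + h) = t - r); last by lra.
by under [in LHS]eq_bigr => i _ do rewrite (E (i%:R / _)) (E (i.+1%:R / _)).
Qed.

End discount.

(** * Measurability in the path *)

Section path_space.
Context {R : realType}.

(** Increments, not values, generate the sigma-algebra: the law of [L (t + h)] depends on [h] in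
    general, that of an increment does not. *)
Definition increment_sets : set (set (R -> R)) :=
  [set C | exists a b : R, exists2 B : set R, measurable B &
    C = [set f | B (f b - f a)]].

Definition path_space := g_sigma_algebraType increment_sets.

Lemma measurable_increment (a b : R) :
  measurable_fun [set: path_space] (fun f : path_space => (f : R -> R) b - (f : R -> R) a).
Proof.
move=> _ B mB; rewrite setTI; apply: sub_sigma_algebra.
by exists a, b, B.
Qed.

Lemma measurable_discount (eta t : R) :
  measurable_fun [set: (path_space * R) * R]
    (fun x => discount eta (x.1.1 : R -> R) t x.1.2 x.2).
Proof.
apply: measurable_fun_limn_esup => k; apply: measurable_fun_limn_esup => n.
apply/measurable_EFinP; apply: measurableT_comp => //.
have mr : measurable_fun [set: (path_space * R) * R] (fun x => x.2).
  exact: measurable_snd.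
have mp : measurable_fun [set: (path_space * R) * R] (fun x => x.1.2).
  exact: (measurableT_comp measurable_snd measurable_fst).
have mf (a b : R) : measurable_fun [set: (path_space * R) * R]
    (fun x => (x.1.1 : R -> R) b - (x.1.1 : R -> R) a).
  exact: (measurableT_comp (measurable_increment a b)
    (measurableT_comp measurable_fst measurable_fst)).
apply: measurable_funB; last by apply: measurable_funM => //; apply: measurable_funB.
apply: measurable_sum => i; apply: measurable_fun_ifT => //.
  apply: measurable_fun_ler => //; apply: measurable_funM => //.
  exact: measurable_funB.
apply: measurableT_comp; first exact: measurable_ln.
apply: measurable_funD => //; apply: measurable_funM => //.
apply: measurable_maxr => //; apply: measurable_funB => //.
exact: measurable_funX.
Qed.

End path_space.

(** * The superposition as a functional of the path *)

Section path_functional.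
Context {R : realType}.
Local Open Scope ereal_scope.

(** Tonelli's theorem on the whole product, applied to the integrand extended by 0 off [D]. *)
Lemma measurable_integral_section d1 d2 (T1 : measurableType d1)
    (T2 : measurableType d2) (m : {sigma_finite_measure set T2 -> \bar R})
    (D : set T2) (F : T1 -> T2 -> \bar R) : measurable D ->
  (forall x y, 0 <= F x y) ->
  measurable_fun [set: T1 * T2] (fun z => F z.1 z.2) ->
  measurable_fun [set: T1] (fun x => \int[m]_(y in D) F x y).
Proof.
move=> mD F0 mF; under eq_fun do rewrite integral_mkcond.
apply: (measurable_fun_fubini_tonelli_F (fun z => (F z.1 \_ D) z.2)) => /=.
  have -> : (fun z => (F z.1 \_ D) z.2) =
      (fun z => if z.2 \in D then F z.1 z.2 else 0).
    by apply/funext => z; rewrite patchE.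
  apply: measurable_fun_ifT => //=.
  apply: (measurable_fun_bool true); rewrite setTI.
  rewrite (_ : _ @^-1` _ = snd @^-1` D).
    by rewrite -[X in measurable X]setTI; exact: measurable_snd.
  by apply/seteqP; split => z /=; [move/set_mem|move/mem_set].
by move=> z; rewrite patchE; case: ifP.
Qed.

(** The translated measure gives each half-open interval its length, which characterises Lebesgue
    measure. *)
Lemma pushforward_lebesgue_translation (h : R) (A : set R) : measurable A ->
  pushforward (@lebesgue_measure R) (fun x => x + h : measurableTypeR R)%R A =
  lebesgue_measure A.
Proof.
have mh : measurable_fun [set: measurableTypeR R]
    ((fun x => x + h)%R : measurableTypeR R -> measurableTypeR R).
  exact: measurable_funD.
move=> mA; apply/esym/(lebesgue_measure_unique
  (mu := [the measure _ _ of pushforward lebesgue_measure _])) => //.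
move=> _ [[a b]] _ <-; rewrite /= /pushforward.
rewrite (_ : _ @^-1` _ = `](a - h)%R, (b - h)%R]%classic).
  rewrite /= !lebesgue_measure_itv/= !lte_fin.
  rewrite ltrD2r; case: ifP => // _.
  by rewrite -!EFinB; congr _%:E; lra.
by apply/seteqP; split => x /=; rewrite !in_itv/= => ?; lra.
Qed.

Lemma integral_translation (h : R) (D : set R) (F : R -> \bar R) :
  measurable D -> measurable_fun [set: R] F -> (forall x, 0 <= F x) ->
  \int[lebesgue_measure]_(r in D) F r =
  \int[lebesgue_measure]_(r in [set r | D (r + h)%R]) F (r + h)%R.
Proof.
move=> mD mF F0.
have mh : measurable_fun [set: measurableTypeR R]
    ((fun x => x + h)%R : measurableTypeR R -> measurableTypeR R).
  exact: measurable_funD.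
rewrite -(ge0_integral_pushforward mh lebesgue_measure mD)//.
  apply: eq_measure_integral => A mA _; apply/esym.
  exact: pushforward_lebesgue_translation.
exact: measurable_funS mF.
Qed.

Definition supcogarch2_path (beta eta : R) (D : set R) (pi : probability R R)
    (t : R) (f : R -> R) : \bar R :=
  \int[pi]_(phi in D) (beta%:E *
    \int[lebesgue_measure]_(r in `]-oo, t]) discount eta f t phi r).

Context (beta eta : R) (D : set R) (pi : probability R R).
Hypotheses (beta0 : (0 <= beta)%R) (mD : measurable D).

Lemma measurable_supcogarch2_path (t : R) :
  measurable_fun [set: @path_space R] (supcogarch2_path beta eta D pi t).
Proof.
pose inner (f : path_space) (phi : R) :=
  \int[lebesgue_measure]_(r in `]-oo, t]) discount eta (f : R -> R) t phi r.
have inner0 f phi : 0 <= inner f phi.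
  by apply: integral_ge0 => r _; exact: discount_ge0.
have minner : measurable_fun [set: path_space * R] (fun z => inner z.1 z.2).
  pose F (z : path_space * R) r := discount eta (z.1 : R -> R) t z.2 r.
  have mF := measurable_discount eta t.
  have F0 z r : 0 <= F z r by exact: discount_ge0.
  have mt : measurable (`]-oo, t]%classic : set (measurableTypeR R)).
    exact: measurable_itv.
  exact: (measurable_integral_section lebesgue_measure mt F0 mF).
pose G (f : path_space) (phi : R) := beta%:E * inner f phi.
have G0 f phi : 0 <= G f phi by rewrite mule_ge0 ?lee_fin.
have mG : measurable_fun [set: path_space * R] (fun z => G z.1 z.2).
  exact: measurable_funeM.
exact: (measurable_integral_section pi mD G0 mG).
Qed.

(** The substitution [r + h] for [r] carries []-oo, t + h]] to []-oo, t]]; then [discount_shift]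
    applies under the integrals. *)
Lemma supcogarch2_path_shift (t h : R) (f : R -> R) :
  supcogarch2_path beta eta D pi (t + h) f =
  supcogarch2_path beta eta D pi t (fun u => f (u + h)%R).
Proof.
apply: eq_integral => phi _; apply: (congr1 (fun x => beta%:E * x)).
pose F r := discount eta f (t + h) phi r.
have mF : measurable_fun [set: R] F.
  have m1 : measurable_fun [set: R] (fun r : R => (((f : path_space), phi), r)).
    exact: measurable_fun_pair.
  exact: (measurableT_comp (measurable_discount eta (t + h)) m1).
have F0 r : 0 <= F r by exact: discount_ge0.
rewrite (integral_translation h (measurable_itv _) mF F0).
have -> : [set r | `]-oo, (t + h)%R]%classic (r + h)%R] = `]-oo, t]%classic.
  by apply/seteqP; split => r /=; rewrite !in_itv/= lerD2r.
by apply: eq_integral => r _; exact: discount_shift.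
Qed.

End path_functional.

(** * Invariance of the law of the increments under time shifts *)

Section shift_invariance.
Context {R : realType}.

Definition increments_in (p : seq R) : set (set (R -> R)) :=
  [set C | exists a b : R, [/\ a \in p, b \in p &
    exists2 B : set R, measurable B & C = [set f | B (f b - f a)]]].

(** These rectangles form the pi-system on which independence factorises the law, which it does not
    do for overlapping increments. *)
Definition successive_increments (s : nat -> R) (n : nat) : set (set (R -> R)) :=
  [set C | exists2 B : nat -> set R, (forall i, measurable (B i)) &
    C = [set f | forall i, (i < n)%N -> B i (f (s i.+1) - f (s i))]].

Lemma g_sigma_algebra_sub (G G' : set (set (R -> R))) :
  G `<=` <<s G' >> -> <<s G >> `<=` <<s G' >>.
Proof.
by move=> GG'; apply: smallest_sub => //; exact: smallest_sigma_algebra.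
Qed.

Lemma setI_closed_successive_increments s n :
  setI_closed (successive_increments s n).
Proof.
move=> _ _ [B mB ->] [B' mB' ->]; exists (fun i => B i `&` B' i).
  by move=> i; exact: measurableI.
apply/seteqP; split => f /=; first by move=> [H H'] i i_n; split; [exact: H|exact: H'].
by move=> H; split => i /H[].
Qed.

Lemma successive_increments_setT s n : successive_increments s n setT.
Proof.
exists (fun=> setT) => //.
by apply/seteqP; split.
Qed.

(** Telescoping: the increment from [s 0] to [s k] is a sum of successive ones, and any other is a
    difference of two of these. *)
Lemma increments_in_successive (p : seq R) (s : nat -> R) (n : nat) :
  (forall a, a \in p -> exists2 i, (i <= n)%N & a = s i) ->
  increments_in p `<=` <<s successive_increments s n >>.
Proof.
move=> ps _ [a [b [/ps[i i_n ->] /ps[j jn ->] [B mB ->]]]].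
pose G := successive_increments s n.
pose GT := g_sigma_algebraType G.
have m1 k : (k < n)%N -> measurable_fun [set: GT]
    (fun f : GT => (f : R -> R) (s k.+1) - (f : R -> R) (s k)).
  move=> kn _ A mA; rewrite setTI; apply: sub_sigma_algebra.
  exists (fun k' => if k' == k then A else setT).
    by move=> k'; case: ifP => // _; exact: measurableT.
  apply/seteqP; split => f /= H; last by have := H k kn; rewrite eqxx.
  by move=> k' _; case: ifPn => // /eqP ->.
have m2 k : (k <= n)%N -> measurable_fun [set: GT]
    (fun f : GT => (f : R -> R) (s k) - (f : R -> R) (s 0%N)).
  elim: k => [|k IH] kn.
    by rewrite (_ : (fun _ => _) = cst 0)//; apply/funext => f /=; rewrite subrr.
  rewrite (_ : (fun _ => _) = (fun f : GT =>
      ((f : R -> R) (s k.+1) - (f : R -> R) (s k)) +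
      ((f : R -> R) (s k) - (f : R -> R) (s 0%N)))).
    by apply: measurable_funD; [exact: m1|exact: IH (ltnW kn)].
  by apply/funext => f; rewrite addrA subrK.
have m3 : measurable_fun [set: GT]
    (fun f : GT => (f : R -> R) (s j) - (f : R -> R) (s i)).
  rewrite (_ : (fun _ => _) = (fun f : GT =>
      ((f : R -> R) (s j) - (f : R -> R) (s 0%N)) -
      ((f : R -> R) (s i) - (f : R -> R) (s 0%N)))).
    by apply: measurable_funB; exact: m2.
  by apply/funext => f; rewrite opprB addrA subrK.
by have := m3 measurableT B mB; rewrite setTI.
Qed.

Lemma sorted_points (p : seq R) : exists s : nat -> R, exists2 n,
  (forall i, (i < n)%N -> s i < s i.+1) &
  forall a, a \in p -> exists2 i, (i <= n)%N & a = s i.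
Proof.
pose q := sort <=%R (undup p).
have sq : sorted <%R q by rewrite lt_sorted_uniq_le sort_uniq undup_uniq sort_le_sorted.
(* There is one increment fewer than points; for empty [p] both conditions are vacuous. *)
exists (nth 0 q), (size q).-1 => [i i_n|a ap].
  have i1 : (i.+1 < size q)%N by rewrite -ltn_predRL.
  by rewrite (sorted_ltn_nth lt_trans)// inE (ltn_trans _ i1).
have aq : a \in q by rewrite mem_sort mem_undup.
exists (index a q); last by rewrite nth_index.
by move: aq; rewrite -index_mem; case: (size q).
Qed.

Definition finite_increments : set (set (R -> R)) :=
  [set C | exists p : seq R, <<s increments_in p >> C].

(** Two sets depending on the points of [p] and of [p'] both belong to the sigma-algebra of
    [p ++ p']. *)
Lemma setI_closed_finite_increments : setI_closed finite_increments.
Proof.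
move=> C C' [p Cp] [p' Cp']; exists (p ++ p').
have sub (q : seq R) : {subset q <= p ++ p'} ->
    <<s increments_in q >> `<=` <<s increments_in (p ++ p') >>.
  move=> qp; apply: g_sigma_algebra_sub => _ [a [b [aq bq [B mB ->]]]].
  by apply: sub_sigma_algebra; exists a, b; split; [exact: qp|exact: qp|exists B].
apply: (@measurableI _ (g_sigma_algebraType (increments_in (p ++ p')))).
  by apply: sub Cp => a ap; rewrite mem_cat ap.
by apply: sub Cp' => a ap; rewrite mem_cat ap orbT.
Qed.

Lemma finite_increments_measurable :
  finite_increments `<=` (@measurable _ (@path_space R)).
Proof.
move=> C [p]; apply: g_sigma_algebra_sub => {}C [a [b [_ _ [B mB ->]]]].
by apply: sub_sigma_algebra; exists a, b, B.
Qed.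

Lemma successive_increments_measurable s n :
  successive_increments s n `<=` (@measurable _ (@path_space R)).
Proof.
move=> _ [B mB ->].
rewrite (_ : mkset _ = \bigcap_i (if (i < n)%N
    then [set f : R -> R | B i (f (s i.+1) - f (s i))] else setT)).
  apply: (@bigcapT_measurable _ path_space) => i; case: ifP => _; last exact: measurableT.
  by apply: sub_sigma_algebra; exists (s i), (s i.+1), (B i).
apply/seteqP; split => f /= H i; first by move=> _; case: ifP => // /H.
by have := H i I; case: ifP.
Qed.

Context d (T : measurableType d) (P : probability T R) (L : R -> T -> R).
Hypothesis levyL : two_sided_levy P L.

Definition shifted_path (h : R) (w : T) : path_space := fun u => L (u + h) w.

Lemma measurable_shifted_path (h : R) : measurable_fun [set: T] (shifted_path h).
Proof.
apply: (@measurability _ _ T path_space _ _ (@increment_sets R)) => //.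
move=> _ [_ [a [b [B mB ->]]] <-].
have m : measurable_fun [set: T] (fun w => L (b + h) w - L (a + h) w).
  by apply: measurable_funB; exact: levy_measurable levyL _.
exact: m measurableT B mB.
Qed.

(** Independence at the shifted times gives a product, and stationarity removes the shift from each
    factor. *)
Lemma shifted_successive_increments (h : R) (s : nat -> R) (n : nat) C :
  (forall i, (i < n)%N -> s i < s i.+1) -> successive_increments s n C ->
  P (shifted_path h @^-1` C) = P (shifted_path 0 @^-1` C).
Proof.
move=> sn [B mB ->].
have E k : P (shifted_path k @^-1`
      [set f | forall i, (i < n)%N -> B i (f (s i.+1) - f (s i))]) =
    (\prod_(i < n) P [set w | B i (L (s i.+1) w - L (s i) w)%R])%E.
  transitivity (P (\big[setI/setT]_(i < n)
      [set w | B i (L (s i.+1 + k) w - L (s i + k) w)])).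
    by rewrite -(bigcap_mkord n (fun i => [set w | B i (L (s i.+1 + k) w - L (s i + k) w)])).
  rewrite (levy_independent levyL (t := fun i => s i + k))//.
    by apply: eq_bigr => i _; rewrite (levy_stationary levyL).
  by move=> i /sn; rewrite ltrD2r.
by rewrite !E.
Qed.

Lemma shifted_path_law (h : R) (C : set path_space) : measurable C ->
  P (shifted_path h @^-1` C) = P (shifted_path 0 @^-1` C).
Proof.
have /choice[m mE] (k : R) : exists m : {measure set path_space -> \bar R},
    forall A, m A = P (shifted_path k @^-1` A).
  unshelve eexists (pushforward P (shifted_path k) : {measure set _ -> \bar R}) => //.
  exact: measurable_shifted_path.
have mfin k : (m k [set: path_space] < +oo)%E.
  by rewrite mE preimage_setT probability_setT ltry.
rewrite -!mE.
(* The measures are finite, so the constant sequence [setT] serves as the exhausting sequence. *)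
have unique (G : set (set path_space)) : G `<=` measurable -> G setT ->
    setI_closed G -> (forall A, G A -> m h A = m 0 A) ->
    forall A, <<s G >> A -> m h A = m 0 A.
  move=> GM GT GI mG; apply: (@g_sigma_algebra_measure_unique _ R path_space G GM
    (fun=> setT)) => //.
  by rewrite bigcup_const.
have step p A : <<s increments_in p >> A -> m h A = m 0 A.
  move=> pA; have [s [n sn ps]] := sorted_points p.
  apply: (unique (successive_increments s n)).
  - exact: successive_increments_measurable.
  - exact: successive_increments_setT.
  - exact: setI_closed_successive_increments.
  - by move=> B; rewrite !mE; exact: shifted_successive_increments.
  - by apply: g_sigma_algebra_sub pA; exact: increments_in_successive.
move=> mC; apply: (unique finite_increments).
- exact: finite_increments_measurable.
- by exists [::]; exact: (@measurableT _ (g_sigma_algebraType _)).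
- exact: setI_closed_finite_increments.
- by move=> A [p]; exact: step.
(* The pi-system of finitely many points generates: an increment from [a] to [b] depends only on the
   points of [[:: a; b]]. *)
- move: C mC; apply: g_sigma_algebra_sub => C [a [b [B mB ->]]].
  apply: sub_sigma_algebra; exists [:: a; b]; apply: sub_sigma_algebra.
  exists a, b; split; [exact: mem_head| |by exists B].
  by rewrite !inE eqxx orbT.
Qed.

End shift_invariance.

(** * Stationarity *)

(** The integral of [ln (1 + phi * y)] is nondecreasing in [phi >= 0], so the set is an interval. *)
Lemma measurable_Phi (R : realType) (eta : R) (nuL : {measure set R -> \bar R}) :
  measurable (Phi eta nuL).
Proof.
apply: is_interval_measurable => x z [x0 _] [z0 zeta] y /andP[xy yz].
have y0 : 0 <= y by exact: le_trans xy.
split => //; apply: le_lt_trans zeta.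
have msq : measurable_fun [set: R] (fun y : R => (y ^+ 2)%R : R).
  exact: measurable_funX.
have [m mE] : exists m : {measure set R -> \bar R},
    m = pushforward nuL (fun y : R => (y ^+ 2)%R : R) :> (set R -> \bar R).
  by unshelve eexists (pushforward nuL (fun y : R => (y ^+ 2)%R : R)
    : {measure set _ -> \bar R}) => //.
rewrite -mE.
have mln (a : R) : measurable_fun (`]0%R, +oo[ : set R) (fun y => (ln (1 + a * y))%:E).
  apply/measurable_EFinP/measurable_funTS; apply: measurableT_comp.
    exact: measurable_ln.
  by apply: measurable_funD => //; exact: measurable_funM.
apply: ge0_le_integral => //.
- move=> u; rewrite /= in_itv/= andbT => /ltW u0.
  by rewrite lee_fin ln_ge0// lerDl mulr_ge0.
- move=> u; rewrite /= in_itv/= andbT => /ltW u0.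
  rewrite lee_fin ler_ln ?posrE ?ltr_wpDr ?mulr_ge0//.
  by rewrite lerD2l ler_wpM2r.
Qed.

(** By covariance, the vector at the times shifted by [h] is one fixed measurable map [G] of the
    path shifted by [h], and [shifted_path_law] applies. The measurable version [Z] of [Y] is [F t]
    evaluated along the path of [L]. *)
Lemma shift_covariant_stationary (R : realType) (d : measure_display)
    (T : measurableType d) (P : probability T R) (L : R -> T -> R)
    (F : R -> (R -> R) -> \bar R) (Y : R -> T -> \bar R) :
  two_sided_levy P L ->
  (forall t, measurable_fun [set: @path_space R] (F t)) ->
  (forall t h f, F (t + h) f = F t (fun u => f (u + h))) ->
  (forall t, {ae P, forall w, F t (L ^~ w) = Y t w}) ->
  strictly_stationary P Y.
Proof.
move=> levyL mF FS FY.
have FE t h w : F (t + h) (L ^~ w) = F t (shifted_path L h w) by exact: FS.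
have FE0 t w : F t (L ^~ w) = F t (shifted_path L 0 w) by rewrite -FE addr0.
exists (fun t w => F t (L ^~ w)); split => // [t|n t h A mA].
  rewrite (_ : (fun _ => _) = F t \o shifted_path L 0).
    exact: measurableT_comp (mF t) (measurable_shifted_path levyL 0).
  by apply/funext => w; exact: FE0.
pose G (f : @path_space R) := [tuple F (tnth t i) f | i < n].
have mG : measurable_fun [set: @path_space R] G.
  apply/measurable_fun_tnthP => i; rewrite (_ : _ \o _ = F (tnth t i))//.
  by apply/funext => f /=; rewrite tnth_mktuple.
have mGA : measurable (G @^-1` A) by rewrite -[X in measurable X]setTI; exact: mG.
have GE w : [tuple F (tnth t i + h) (L ^~ w) | i < n] = G (shifted_path L h w).
  by apply: eq_from_tnth => i; rewrite !tnth_mktuple; exact: FE.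
have GE0 w : [tuple F (tnth t i) (L ^~ w) | i < n] = G (shifted_path L 0 w).
  by apply: eq_from_tnth => i; rewrite !tnth_mktuple; exact: FE0.
transitivity (P (shifted_path L h @^-1` (G @^-1` A))).
  by apply: congr1; apply/funext => w /=; rewrite GE.
rewrite shifted_path_law//.
by apply: congr1; apply/funext => w /=; rewrite GE0.
Qed.

Theorem theorem3p10 (R : realType) (d : measure_display)
    (T : measurableType d) (P : probability T R)
    (beta eta : R) (beta_gt0 : 0 < beta) (eta_gt0 : 0 < eta)
    (L : R -> T -> R) (levyL : two_sided_levy P L)
    (nuL : {measure set R -> \bar R}) (nuLP : levy_measure P L nuL)
    (S : R -> T -> R)
    (SP : {ae P, forall w,
             squared_jump_path (L ^~ w) (S ^~ w)})
    (pi : probability R R) (piPhi : pi (Phi eta nuL) = 1%E)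
    (Vfin : {ae P, forall w,
       (\int[pi]_(phi in Phi eta nuL)
          cogarchV beta eta (S ^~ w) phi 0 < +oo)%E}) :
  strictly_stationary P
    (fun t w => supcogarch2 beta eta nuL pi (S ^~ w) t).
Proof.
have mPhi := measurable_Phi eta nuL.
apply: (shift_covariant_stationary
  (F := supcogarch2_path beta eta (Phi eta nuL) pi) levyL).
- by move=> t; apply: measurable_supcogarch2_path => //; exact: ltW.
- exact: supcogarch2_path_shift.
(* The exceptional null set comes from the two path properties alone, so outside it [discountE]
   holds for all [phi] in [Phi] and all [r <= t] at once, under both integrals. *)
- move=> t; apply: filterS2 (levy_cadlag levyL) SP => w cL sq.
  apply: eq_integral => phi /set_mem[phi0 _].
  apply: (congr1 (fun x => (beta%:E * x)%E)); apply: eq_integral => r.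
  by rewrite inE /= in_itv/= => rt; exact: discountE.
Qed.
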